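(* Let $f:\mathbb{X}\to\mathbb{R}$ be a finite measurable function such that $\lim_n B_nf=c$ $\mu$-a.e. with $c\in\mathbb{R}$ finite. Then neither the set of points $x$ for which $B_nf(x)-c>0$ for all sufficiently large $n$, nor the set of points $x$ for which $B_nf(x)-c<0$ for all sufficiently large $n$, has positive measure. That is, $\mu\big(\bigcup_{N>0}\bigcap_{n>N}\{B_nf>c\}\big)=0$ and $\mu\big(\bigcup_{N>0}\bigcap_{n>N}\{B_nf<c\}\big)=0$.
   Context: Standing assumptions: $(\mathbb{X},\mathcal{X},\mu,T)$ is a probability space with $T$ an invertible, bi-measurable, measure-preserving, ergodic transformation. $B_nf=\frac{1}{2n+1}\sum_{i=-n}^{n}f\circ T^i$. *)

(* Defs.v *)
From HB Require Import structures.
From mathcomp Require Import all_boot all_order all_algebra.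
From mathcomp Require Import all_classical all_reals all_analysis.
Set Implicit Arguments. Unset Strict Implicit. Unset Printing Implicit Defensive.
Import Order.TTheory GRing.Theory Num.Theory.
Local Open Scope classical_set_scope.
Local Open Scope ring_scope.

Definition iterz (X : Type) (T Tinv : X -> X) (i : int) : X -> X :=
  match i with
  | Posz n => iter n T
  | Negz n => iter n.+1 Tinv
  end.

Definition Bavg (R : realType) (X : Type) (T Tinv : X -> X) (f : X -> R)
    (n : nat) (x : X) : R :=
  (n.*2.+1%:R)^-1 *
    \sum_(0 <= k < n.*2.+1) f (iterz T Tinv (k%:Z - n%:Z) x).

Definition invertible_mpt_ergodic (d : measure_display) (X : measurableType d)
    (R : realType) (mu : {measure set X -> \bar R}) (T Tinv : X -> X) : Prop :=
  cancel T Tinv /\ cancel Tinv T /\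
  measurable_fun setT T /\ measurable_fun setT Tinv /\
  (forall A, measurable A -> mu (T @^-1` A) = mu A) /\
  (forall A, measurable A -> T @^-1` A = A -> mu A = 0%E \/ mu A = 1%E).

(* Main.v *)
(** Assume [c = 0] and let [G k] be the [k]-th Birkhoff sum along the orbit of [x].
    The symmetric average centred at [T^m x] compares [G] at two points that are
    mirror images of each other under the reflection of time through [m]. If the
    averages at the points of some set [A] are positive from rank [N] on, then
    reflecting a time [a] through a later visit to [A] increases [G]. When
    [mu A > 0], ergodicity makes such visits frequent, most reflections are short
    and most short ones gain a definite amount, so a chain of reflections makes [G]
    grow linearly. On the other hand, the convergence to [0] makes almost every
    reflection change [G] only sublinearly, and two reflections compose to an
    arbitrary even translation, so [G b = o(n)] uniformly in [b <= n]; this is a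
    contradiction. Exceptional times are counted with Markov's inequality. *)
Require Import Defs.
From HB Require Import structures.
From mathcomp Require Import all_boot all_order all_algebra.
From mathcomp Require Import all_classical all_reals all_analysis.
From mathcomp Require Import measurable_realfun zify ring lra.
Set Implicit Arguments. Unset Strict Implicit. Unset Printing Implicit Defensive.
Import Order.TTheory GRing.Theory Num.Theory numFieldNormedType.Exports.
Local Open Scope classical_set_scope.
Local Open Scope ring_scope.

(** * Reflections of a sequence *)

Lemma leq_sum_nat_sub (b : pred nat) (i j m n : nat) :
  (i <= m)%N -> (n <= j)%N ->
  (\sum_(m <= k < n) b k <= \sum_(i <= k < j) b k)%N.
Proof.
move=> im nj; have [mn|/ltnW nm] := leqP m n; last by rewrite big_geq.
rewrite (big_cat_nat _ (leq_trans mn nj)) //= [leqRHS]addnC.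
by rewrite (big_cat_nat mn nj) /= -addnA leq_addr.
Qed.

Lemma sum_nat_all (b : pred nat) (m n : nat) :
  (forall k, (m <= k < n)%N -> b k) -> (\sum_(m <= k < n) b k = n - m)%N.
Proof.
move=> bT; rewrite (eq_big_nat _ _ (F2 := fun=> 1%N)) ?sum_nat_const_nat ?muln1//.
by move=> k /bT ->.
Qed.

(* [A] marks the admissible centres, [b1] the times from which none is near, [b2]
   those from which some short reflection gains less than [delta]. From time [a]
   one reflects through the nearest centre: a short reflection gains [delta] unless
   [b2 a], and at least a quarter of the span of a long one consists of [b1] times. *)
Lemma reflection_chain (R : realFieldType) (G : nat -> R) (A b1 b2 : pred nat)
    (N K : nat) (delta c : R) :
  (forall a n, (N < n)%N -> A (a + n)%N -> G a <= G (a + n.*2.+1)%N) ->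
  (forall a, (forall n, (N < n <= K)%N -> ~~ A (a + n)%N) -> b1 a) ->
  (forall a n, ~~ b2 a -> (N < n <= K.*2)%N -> A (a + n)%N ->
    G a + delta <= G (a + n.*2.+1)%N) ->
  0 <= c -> c * (4 * K).+1%:R <= delta ->
  forall n a : nat, (a <= n)%N ->
  exists2 b, (a <= b <= n)%N &
    c * ((n - a)%:R - 4 * (\sum_(a <= i < n) b1 i)%:R
         - (4 * K).+1%:R * (\sum_(a <= i < n) b2 i)%:R - (4 * K).+1%:R)
    <= G b - G a.
Proof.
set L := (4 * K).+1.
move=> hA hb1 hb2 c0 cL n a an.
have [k] := ubnP (n - a); elim: k a an => // k IH a an nak.
have [/existsP[/= m0]|] :=
  boolP [exists m : 'I_n.+1, (N < m)%N && A (a + m)%N && (a + m.*2.+1 <= n)%N].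
  move=> h0.
  have : exists m, (N < m)%N && A (a + m)%N && (a + m.*2.+1 <= n)%N by exists m0.
  (* Taking the least [m] leaves no admissible centre [a + m'] with N < m' < m. *)
  move=> /ex_minnP[m /andP[/andP[Nm Am] mn] minm] {m0 h0}.
  have [||b /andP[b0 bn] hb] := IH (a + m.*2.+1)%N; [by lia|by lia|].
  exists b; first by lia.
  rewrite (_ : G b - G a = (G b - G (a + m.*2.+1)%N) + (G (a + m.*2.+1)%N - G a));
    last by lra.
  have aj : (a <= a + m.*2.+1)%N by lia.
  rewrite !(big_cat_nat aj mn) /=.
  set B1 := (\sum_(a + m.*2.+1 <= i < n) b1 i)%N in hb *.
  set B2 := (\sum_(a + m.*2.+1 <= i < n) b2 i)%N in hb *.
  set C1 := (\sum_(a <= i < a + m.*2.+1) b1 i)%N.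
  set C2 := (\sum_(a <= i < a + m.*2.+1) b2 i)%N.
  suff H : c * (m.*2.+1%:R - 4 * C1%:R - L%:R * C2%:R) <= G (a + m.*2.+1)%N - G a.
    rewrite (_ : (n - a)%:R = (n - (a + m.*2.+1))%:R + m.*2.+1%:R :> R);
      last by rewrite -natrD; congr _%:R; lia.
    rewrite !natrD; apply: le_trans (lerD hb H).
    by rewrite -mulrDr ler_wpM2l//; lra.
  have gain0 : 0 <= G (a + m.*2.+1)%N - G a by rewrite subr_ge0 hA.
  have [mK|Km] := leqP m K.*2.
    have Lm : m.*2.+1%:R <= L%:R :> R by rewrite ler_nat; lia.
    have [b2a|nb2a] := boolP (b2 a).
      have C2pos : 1 <= C2%:R :> R.
        have := @leq_sum_nat_sub b2 a (a + m.*2.+1) a a.+1 (leqnn a).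
        by rewrite big_nat1 b2a ler1n; apply; lia.
      apply: le_trans gain0; rewrite mulr_ge0_le0//.
      have : L%:R <= L%:R * C2%:R :> R by rewrite ler_peMr.
      by have := ler0n R C1; lra.
    have gaind := hb2 a m nb2a; rewrite Nm mK in gaind.
    have {}gaind := gaind erefl Am.
    apply: (@le_trans _ _ (c * L%:R)); last by lra.
    rewrite ler_wpM2l//.
    have := ler0n R C1; have : 0 <= L%:R * C2%:R :> R by rewrite mulr_ge0.
    by lra.
  (* If one of the first [m - K] times had a centre at distance in (N, K], that centre would lie
     before [a + m], against minimality. From [K.*2 < m] it then follows that 4(m - K) >= 2m + 1. *)
  have hC1 : (m - K <= C1)%N.
    have := @leq_sum_nat_sub b1 a (a + m.*2.+1) a (a + (m - K)) (leqnn a).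
    rewrite sum_nat_all; first by move=> /(_ ltac:(lia)); rewrite addKn.
    move=> k' k'm; apply: hb1 => j /andP[Nj jK]; apply/negP => Aj.
    have : (m <= k' - a + j)%N.
      by apply: minm; rewrite (_ : (a + (k' - a + j) = k' + j)%N) ?Aj; lia.
    by lia.
  apply: le_trans gain0; rewrite mulr_ge0_le0//.
  have : m.*2.+1%:R <= 4 * C1%:R :> R by rewrite -natrM ler_nat; lia.
  have : 0 <= L%:R * C2%:R :> R by rewrite mulr_ge0.
  by lra.
(* No reflection from [a] lands by time [n], so the chain stops at [a] and the bracket must be
   nonpositive. Either the final [L] absorbs the span, or roughly its first half, less [K] times,
   consists of [b1] times. *)
move=> /existsPn nom; exists a; first by lia.
rewrite subrr mulr_ge0_le0//.
have L2 : 0 <= L%:R * (\sum_(a <= i < n) b2 i)%:R :> R by rewrite mulr_ge0.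
have [naL|Lna] := leqP (n - a) L.
  have : (n - a)%:R <= L%:R :> R by rewrite ler_nat.
  by have := ler0n R (\sum_(a <= i < n) b1 i); lra.
have : (n - a <= 4 * \sum_(a <= i < n) b1 i)%N.
  have := @leq_sum_nat_sub b1 a n a (a + ((n - a).-1./2 - K).+1) (leqnn a).
  rewrite sum_nat_all; last first.
    move=> k' k'm; apply: hb1 => j /andP[Nj jK].
    have jn : (k' - a + j < n.+1)%N by lia.
    have := nom (Ordinal jn); rewrite /= -andbA !negb_and.
    rewrite (_ : (a + (k' - a + j) = k' + j)%N); last by lia.
    by move=> /or3P[|//|]; lia.
  by move=> /(_ ltac:(lia)); lia.
rewrite -(ler_nat R) natrM => ?.
by have := ler0n R L; lra.
Qed.

(* Reflecting through [a + m] and then [a + m + t] translates by [2t]; the bound on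
   the exceptional centres leaves an [m] in [2n, 3n) for which both are usable. *)
Lemma double_reflection (R : realFieldType) (G : nat -> R) (h : pred nat)
    (N n a t : nat) (eta : R) :
  (forall a n, (N <= n)%N -> h (a + n)%N ->
    `|G (a + n.*2.+1)%N - G a| <= eta * n.*2.+1%:R) ->
  0 <= eta -> (N <= n)%N -> (a <= 1)%N -> (t <= n)%N ->
  ((\sum_(0 <= i < (4 * n).+1) ~~ h i).*2 < n)%N ->
  `|G (a + t.*2)%N - G a| <= 12 * (eta * n%:R).
Proof.
move=> hG eta0 Nn a1 tn hn.
have [/existsP[/= i /andP[hi hit]]|/existsPn nex] :=
    boolP [exists i : 'I_n, h (a + (n.*2 + i))%N && h (a + (n.*2 + i) + t)%N].
  (* Both [a] and [a + t.*2] have mirror image [a + m.*2.+1], the latter through [a + m + t] with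
     radius [m - t], which is at least [N] since m >= 2n and t <= n. *)
  set m := (n.*2 + i)%N in hi hit.
  have im : (m < 3 * n)%N by have := ltn_ord i; lia.
  have := hG a m ltac:(lia) hi.
  have := hG (a + t.*2)%N (m - t)%N ltac:(lia).
  rewrite (_ : (a + t.*2 + (m - t) = a + m + t)%N); last by lia.
  move=> /(_ hit).
  rewrite (_ : (a + t.*2 + (m - t).*2.+1 = a + m.*2.+1)%N); last by lia.
  have : eta * (m - t).*2.+1%:R <= 6 * (eta * n%:R).
    by rewrite mulrCA ler_wpM2l// -natrM ler_nat; lia.
  have : eta * m.*2.+1%:R <= 6 * (eta * n%:R).
    by rewrite mulrCA ler_wpM2l// -natrM ler_nat; lia.
  by rewrite !ler_norml => ? ? /andP[? ?] /andP[? ?]; apply/andP; split; lra.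
(* Otherwise each of the n indices gives a bad centre in one of two windows of length n. As a <= 1
   and t <= n, both windows lie in [0, 4n], so n is at most twice the number of bad centres. *)
exfalso; move: hn; apply/negP; rewrite -leqNgt -addnn.
have shift s : (s + n <= (4 * n).+1)%N ->
    (\sum_(0 <= i < n) ~~ h (s + i) <= \sum_(0 <= i < (4 * n).+1) ~~ h i)%N.
  move=> sn; have := @leq_sum_nat_sub (predC h) 0 (4 * n).+1 s (s + n) (leq0n s) sn.
  rewrite -{1}[s]add0n big_addn addKn.
  by under eq_bigr do rewrite /= addnC.
have := shift (a + n.*2)%N ltac:(lia); have := shift (a + n.*2 + t)%N ltac:(lia).
move=> s1 s2; apply: leq_trans (leq_add s1 s2).
rewrite -big_split /= big_mkord -[leqLHS]card_ord -sum1_card leq_sum// => i _.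
have := nex i; rewrite negb_and (addnA a) (addnAC _ i t).
by case/orP => ->; rewrite ?addn1.
Qed.

(** The chain reaches some b <= n with G b >= 25 eta n. Since b is its parity plus an even
    translation, double reflection and the bound on [G 1] give G b <= 13 eta n. *)
Lemma reflection_contradiction (R : realFieldType) (G : nat -> R)
    (A b1 b2 h : pred nat) (N K N1 n : nat) (delta eta : R) :
  G 0%N = 0 ->
  (forall a m, (N < m)%N -> A (a + m)%N -> G a <= G (a + m.*2.+1)%N) ->
  (forall a, (forall m, (N < m <= K)%N -> ~~ A (a + m)%N) -> b1 a) ->
  (forall a m, ~~ b2 a -> (N < m <= K.*2)%N -> A (a + m)%N ->
    G a + delta <= G (a + m.*2.+1)%N) ->
  (forall a m, (N1 <= m)%N -> h (a + m)%N ->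
    `|G (a + m.*2.+1)%N - G a| <= eta * m.*2.+1%:R) ->
  0 < eta -> 100 * eta * (4 * K).+1%:R = delta ->
  0 < n%:R :> R -> (N1 <= n)%N -> 4 * (4 * K).+1%:R <= n%:R :> R ->
  `|G 1%N| <= eta * n%:R ->
  (\sum_(0 <= i < n) b1 i)%:R < n%:R / 16 :> R ->
  (4 * K).+1%:R * (\sum_(0 <= i < n) b2 i)%:R < n%:R / 4 :> R ->
  ((\sum_(0 <= i < (4 * n).+1) ~~ h i).*2 < n)%N -> False.
Proof.
move=> G0 hA hb1 hb2 hG eta0 etadelta n0 N1n Ln G1 B1n B2n hn.
have c0 : 0 <= 100 * eta by lra.
have [b /andP[_ bn]] := reflection_chain hA hb1 hb2 c0
  (eq_ind_r (fun z => z <= delta) (lexx delta) etadelta) (leq0n n).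
rewrite subn0 G0 subr0 => Gb.
have odd1 : (odd b <= 1)%N by case: (odd b).
have bhalf : (b./2 <= n)%N by move: bn; clear; lia.
have := double_reflection hG (ltW eta0) N1n odd1 bhalf hn.
rewrite odd_double_half.
have : `|G (odd b)| <= eta * n%:R.
  by case: (odd b) => //; rewrite G0 normr0 mulr_ge0 ?ltW.
have : 0 < eta * n%:R by rewrite mulr_gt0.
(* Each of the three losses in the chain bound is at most n/4, so at least n/4 remains, at slope 100
   eta. *)
have : 25 * (eta * n%:R) <= G b.
  apply: le_trans Gb; rewrite mulrA (_ : 25 * eta * n%:R = 100 * eta * (n%:R / 4)).
    by rewrite ler_wpM2l//; lra.
  by lra.
rewrite !ler_norml; move: (eta * n%:R) (G b) (G (odd b)); clear.
by move=> e u v ? ? /andP[? ?] /andP[? ?]; lra.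
Qed.

(** * Visits of an orbit to a set *)

Lemma iterz_iter (X : Type) (T Tinv : X -> X) (n k : nat) (x : X) :
  cancel T Tinv -> iterz T Tinv (k%:Z - n%:Z) (iter n T x) = iter k T x.
Proof.
move=> TK; have TinvK m y : iter m Tinv (iter m T y) = y.
  by elim: m y => // m IH y; rewrite iterSr iterS TK IH.
have [nk|kn] := leqP n k.
  rewrite -(subnK nk) PoszD addrK /= iterD.
  by [].
rewrite -(subnK (ltnW kn)) [in X in _ - X]PoszD opprD addrCA subrr addr0.
case: (n - k)%N (subn_gt0 k n) => [|m _]; first by rewrite kn.
by rewrite -NegzE iterD; exact: (TinvK m.+1).
Qed.

Lemma preimage_iter_measure (d : measure_display) (X : measurableType d)
    (R : realType) (mu : {measure set X -> \bar R}) (T : X -> X) :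
  measurable_fun setT T ->
  (forall A, measurable A -> mu (T @^-1` A) = mu A) ->
  forall n, measurable_fun setT (iter n T) /\
    forall A, measurable A -> mu (iter n T @^-1` A) = mu A.
Proof.
move=> mT muT; elim=> [|n [mTn muTn]]; first by split => //; exact: measurable_id.
split => [|A mA]; first exact: measurableT_comp.
rewrite (_ : _ @^-1` A = iter n T @^-1` (T @^-1` A))// muTn ?muT//.
by rewrite -[X in measurable X]setTI; exact: mT.
Qed.

Lemma measurable_set_ler (d : measure_display) (X : measurableType d)
    (R : realType) (g h : X -> R) :
  measurable_fun setT g -> measurable_fun setT h ->
  measurable [set x | g x <= h x].
Proof.
move=> mg mh; have := measurable_fun_ler mg mh measurableT (Y := [set true]) I.
by rewrite setTI preimage_true.
Qed.

Lemma measurable_set_ltr (d : measure_display) (X : measurableType d)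
    (R : realType) (g h : X -> R) :
  measurable_fun setT g -> measurable_fun setT h ->
  measurable [set x | g x < h x].
Proof.
move=> mg mh; have := measurable_fun_ltr mg mh measurableT (Y := [set true]) I.
by rewrite setTI preimage_true.
Qed.

(** By invariance the expected number of visits in [M] steps is M mu(B); the bound is then Markov's
    inequality. *)
Lemma markov_visits (d : measure_display) (X : measurableType d)
    (R : realType) (mu : {measure set X -> \bar R}) (T : X -> X) (B : set X)
    (M : nat) (q : R) :
  measurable_fun setT T ->
  (forall A, measurable A -> mu (T @^-1` A) = mu A) ->
  measurable B -> 0 <= q ->
  measurable [set x | q <= (\sum_(0 <= i < M) (iter i T x \in B))%:R] /\
  (q%:E * mu [set x | (q <= (\sum_(0 <= i < M) (iter i T x \in B))%:R)%R]
    <= M%:R%:E * mu B)%E.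
Proof.
move=> mT muT mB q0.
have mpre i : measurable (iter i T @^-1` B).
  by rewrite -[X in measurable X]setTI; apply: (preimage_iter_measure mT muT i).1.
have sumE x : (\sum_(0 <= i < M) (iter i T x \in B))%:R =
    \sum_(0 <= i < M) \1_(iter i T @^-1` B) x :> R.
  rewrite natr_sum; apply: eq_bigr => i _; rewrite indicE; congr (_%:R).
have msum : measurable_fun setT
    (fun x => \sum_(0 <= i < M) \1_(iter i T @^-1` B) x : R).
  by apply: measurable_sum => i; exact: measurable_indic.
set C := [set x | _].
have mC : measurable C.
  have -> : C = [set x | q <= \sum_(0 <= i < M) \1_(iter i T @^-1` B) x].
    by apply/seteqP; split => x; rewrite /C /= sumE.
  exact: (measurable_set_ler (measurable_cst q) msum).
split => //.
rewrite -[X in (q%:E * mu X)%E]setIT -integral_indic// -ge0_integralZl_EFin//; last first.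
  by apply/measurable_EFinP; exact: measurable_indic.
apply: (@le_trans _ _ (\int[mu]_x (\sum_(0 <= i < M) (\1_(iter i T @^-1` B) x)%:E))%E).
  apply: ge0_le_integral => //.
  - by move=> x _; rewrite mule_ge0 ?lee_fin.
  - by apply: measurable_funeM; apply/measurable_EFinP; exact: measurable_indic.
  - by apply: emeasurable_sum => i; apply/measurable_EFinP; exact: measurable_indic.
  move=> x _; rewrite sumEFin -EFinM lee_fin -sumE indicE.
  by have [|_] := boolP (x \in C); rewrite ?inE ?mulr1 ?mulr0// ler0n.
rewrite ge0_integral_sum//; last by move=> i; apply/measurable_EFinP; exact: measurable_indic.
rewrite (eq_bigr (fun=> mu B)) => [|i _]; last first.
  by rewrite integral_indic// setIT (preimage_iter_measure mT muT i).2.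
by rewrite sumr_const_nat subn0 mule_natl.
Qed.

Lemma nonincreasing_null_small (d : measure_display) (X : measurableType d)
    (R : realType) (mu : probability X R) (B : nat -> set X) (e : R) :
  (forall n, measurable (B n)) -> nonincreasing_seq B ->
  mu.-negligible (\bigcap_n B n) -> 0 < e -> exists n, (mu (B n) < e%:E)%E.
Proof.
move=> mB Bdec Bnull e0.
have mcap : measurable (\bigcap_n B n) by exact: bigcapT_measurable.
have /(nonincreasing_cvg_mu) : (mu (B 0%N) < +oo)%E.
  by rewrite (le_lt_trans (probability_le1 _ _))// ltry.
move=> /(_ mB mcap Bdec); rewrite (proj1 (negligibleP _ mcap) Bnull).
move=> /fine_cvgP[_] /cvgrPdist_lt/(_ _ e0)[n _ /(_ n (leqnn n))] /=.
rewrite sub0r normrN ger0_norm ?fine_ge0// => h; exists n.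
by rewrite -(fineK (fin_num_measure _ _ (mB n))) lte_fin.
Qed.

(** The limsup set is exactly invariant, and each tail union contains a preimage of [A], of measure
    mu(A) > 0, so ergodicity forces full measure. *)
Lemma visits_infinitely_often (d : measure_display) (X : measurableType d)
    (R : realType) (mu : probability X R) (T : X -> X) (A : set X) :
  measurable_fun setT T ->
  (forall A, measurable A -> mu (T @^-1` A) = mu A) ->
  (forall A, measurable A -> T @^-1` A = A -> mu A = 0%E \/ mu A = 1%E) ->
  measurable A -> mu A != 0%E ->
  mu.-negligible (~` lim_sup_set (fun n => iter n T @^-1` A)).
Proof.
move=> mT muT erg mA muA0; set F := (fun n => _).
have mF n : measurable (F n).
  by rewrite -[X in measurable X]setTI; apply: (preimage_iter_measure mT muT n).1.
have mL : measurable (lim_sup_set F).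
  by apply: bigcapT_measurable => k; exact: bigcup_measurable.
have inv : T @^-1` (lim_sup_set F) = lim_sup_set F.
  apply/seteqP; split => x /= h n _.
    by have [k /= nk Fk] := h n I; exists k.+1; [exact: leqW|rewrite /F /= -iterS iterSr].
  (* Asking for a visit from time n + 1 on ensures that its index has a predecessor. *)
  by have [[|k]//= nk Fk] := h n.+1 I; exists k => //; rewrite /F /= -iterSr.
have ge : (mu A <= mu (lim_sup_set F))%E.
  have cv : mu (\bigcup_(k >= n) F k) @[n --> \oo] --> mu (lim_sup_set F).
    apply: lim_sup_set_cvg => //.
    by rewrite (le_lt_trans (probability_le1 _ _)) ?ltry//; exact: bigcup_measurable.
  rewrite -(cvg_lim _ cv)//; apply: lime_ge; first by apply/cvg_ex; eexists; exact: cv.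
  apply: nearW => n; rewrite -((preimage_iter_measure mT muT n).2 _ mA).
  apply: le_measure; rewrite ?inE//; [exact: mF|exact: bigcup_measurable|].
  by move=> x Ax; exists n => /=.
have L1 : mu (lim_sup_set F) = 1%E.
  have [h|//] := erg _ mL inv.
  by move: ge muA0; rewrite h measure_le0 => ->.
apply/negligibleP; first exact: measurableC.
by apply: etrans (probability_setC mu mL) _; rewrite L1 subee.
Qed.

Lemma visits_often_small (d : measure_display) (X : measurableType d)
    (R : realType) (mu : probability X R) (T : X -> X) (B : set X)
    (M : nat) (q e r : R) :
  measurable_fun setT T ->
  (forall A, measurable A -> mu (T @^-1` A) = mu A) ->
  measurable B -> 0 < q -> (mu B < e%:E)%E -> M%:R * e <= r * q ->
  measurable [set x | q <= (\sum_(0 <= i < M) (iter i T x \in B))%:R] /\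
  (mu [set x | (q <= (\sum_(0 <= i < M) (iter i T x \in B))%:R)%R] <= r%:E)%E.
Proof.
move=> mT muT mB q0 Be Mr.
have [mC] := markov_visits M mT muT mB (ltW q0).
set C := [set x | _] in mC * => qC; split => //.
rewrite -(@lee_pmul2l _ q%:E) ?lte_fin//; apply: (le_trans qC).
apply: (@le_trans _ _ (M%:R%:E * e%:E)%E); first by rewrite lee_wpmul2l ?lee_fin// ltW.
by rewrite -!EFinM lee_fin mulrC [leRHS]mulrC mulrC.
Qed.

(** * Birkhoff sums and symmetric averages *)

Definition birkhoff_sum (R : realType) (X : Type) (T : X -> X) (F : X -> R)
    (x : X) (k : nat) : R := \sum_(0 <= i < k) F (iter i T x).

Lemma birkhoff_sumD (R : realType) (X : Type) (T : X -> X) (F : X -> R)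
    (x : X) (a k : nat) :
  birkhoff_sum T F x (a + k) = birkhoff_sum T F x a + birkhoff_sum T F (iter a T x) k.
Proof.
rewrite /birkhoff_sum (big_cat_nat (leq0n a) (leq_addr k a)) /=; congr (_ + _).
rewrite -{1}[a]add0n big_addn addKn; apply: eq_bigr => i _.
by rewrite iterD.
Qed.

(* The symmetric average centred at [T^(a+n) x] is the increment of the Birkhoff
   sums between [a] and its mirror image [a + (2n+1)]. *)
Lemma birkhoff_sum_reflect (R : realType) (X : Type) (T Tinv : X -> X)
    (F : X -> R) (x : X) (a n : nat) :
  cancel T Tinv ->
  birkhoff_sum T F x (a + n.*2.+1) - birkhoff_sum T F x a =
  n.*2.+1%:R * Bavg T Tinv F n (iter (a + n) T x).
Proof.
move=> TK; rewrite birkhoff_sumD addrAC subrr add0r /Bavg mulVKf ?pnatr_eq0//.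
by apply: eq_bigr => k _; rewrite [in RHS]addnC iterD iterz_iter.
Qed.

Lemma measurable_iterz (d : measure_display) (X : measurableType d)
    (T Tinv : X -> X) (i : int) :
  measurable_fun setT T -> measurable_fun setT Tinv ->
  measurable_fun setT (iterz T Tinv i).
Proof.
have mi (f : X -> X) n : measurable_fun setT f -> measurable_fun setT (iter n f).
  move=> mf; elim: n => [|n IH]; first exact: measurable_id.
  exact: measurableT_comp.
by move=> mT mTi; case: i => n; exact: mi.
Qed.

Lemma measurable_Bavg (d : measure_display) (X : measurableType d) (R : realType)
    (T Tinv : X -> X) (F : X -> R) (n : nat) :
  measurable_fun setT T -> measurable_fun setT Tinv -> measurable_fun setT F ->
  measurable_fun setT (Bavg T Tinv F n).
Proof.
move=> mT mTi mF; apply: measurable_funM; first exact: measurable_cst.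
apply: measurable_sum => i; apply: measurableT_comp => //.
exact: measurable_iterz.
Qed.

Lemma measurable_birkhoff_sum (d : measure_display) (X : measurableType d)
    (R : realType) (T : X -> X) (F : X -> R) (k : nat) :
  measurable_fun setT T -> measurable_fun setT F ->
  measurable_fun setT (fun x => birkhoff_sum T F x k).
Proof.
move=> mT mF; apply: measurable_sum => i; apply: measurableT_comp => //.
exact: (@measurable_iterz _ _ T T i).
Qed.

(** * Choice of a typical orbit and the contradiction *)

Lemma exists_outside4 (d : measure_display) (X : measurableType d)
    (R : realType) (mu : probability X R) (U1 U2 U3 U4 : set X) :
  measurable U1 -> measurable U2 -> measurable U3 -> measurable U4 ->
  (mu U1 <= (8^-1)%:E)%E -> (mu U2 <= (8^-1)%:E)%E ->
  (mu U3 <= (8^-1)%:E)%E -> (mu U4 <= (8^-1)%:E)%E ->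
  exists x, [/\ ~ U1 x, ~ U2 x, ~ U3 x & ~ U4 x].
Proof.
move=> m1 m2 m3 m4 h1 h2 h3 h4; apply: contrapT => nx.
have UT : U1 `|` U2 `|` (U3 `|` U4) = setT.
  apply/seteqP; split => // x _; apply: contrapT => nU; apply: nx; exists x.
  by split => h; apply: nU; [left; left|left; right|right; left|right; right].
have : (mu (U1 `|` U2 `|` (U3 `|` U4)) <= (8^-1)%:E + (8^-1)%:E + ((8^-1)%:E + (8^-1)%:E))%E.
  have m12 := measurableU _ _ m1 m2; have m34 := measurableU _ _ m3 m4.
  apply: (le_trans (measureU2 mu m12 m34)).
  by apply: leeD; (apply: le_trans; [exact: measureU2|]); exact: leeD.
by rewrite UT probability_setT -!EFinD lee_fin; lra.
Qed.

(** The parameters [K], [j], [N1], [C] are fixed in this order, each making one exceptional set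
    small, and then [n] is taken large. A point outside the resulting bad sets has Birkhoff sums
    that [reflection_contradiction] rules out. *)
Lemma eventually_positive_null (d : measure_display) (X : measurableType d)
    (R : realType) (mu : probability X R) (T Tinv : X -> X) (F : X -> R) (N : nat) :
  invertible_mpt_ergodic mu T Tinv -> measurable_fun setT F ->
  {ae mu, forall x, (fun n : nat => Bavg T Tinv F n x) @ \oo --> 0} ->
  mu [set x | forall n, (N < n)%N -> 0 < Bavg T Tinv F n x] = 0%E.
Proof.
move=> [TK [_ [mT [mTi [muT erg]]]]] mF cvF.
set A := [set x | _].
have mBavg n := measurable_Bavg n mT mTi mF.
have mTn n : measurable_fun setT (iter n T) := (preimage_iter_measure mT muT n).1.
have mpre n B : measurable B -> measurable (iter n T @^-1` B).
  by move=> mB; rewrite -[X in measurable X]setTI; exact: mTn.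
have mA : measurable A.
  rewrite (_ : A = \bigcap_(n in [set n | (N < n)%N]) [set x | 0 < Bavg T Tinv F n x])//.
  apply: bigcap_measurableType => n _.
  by apply: measurable_set_ltr => //; exact: measurable_cst.
apply/eqP; apply: contraT => muA0; exfalso.
pose P1 K := \bigcap_(n in [set n | (N < n <= K)%N]) ~` (iter n T @^-1` A).
have mP1 K : measurable (P1 K).
  by apply: bigcap_measurableType => n _; apply: measurableC; exact: mpre.
(* Almost every orbit meets [A] infinitely often, so [P1 K] decreases to a null set. The bound 1/128
   = (1/8)(1/16) matches the count n/16 allowed for [b1]. *)
have [K P1K] : exists K, (mu (P1 K) < (128^-1)%:E)%E.
  apply: nonincreasing_null_small => //.
    move=> m n mn; apply/subsetPset => x P1x k /= /andP[Nk km].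
    by apply: P1x; rewrite /= Nk (leq_trans km).
  apply: negligibleS (visits_infinitely_often mT muT erg mA muA0).
  move=> x P1x /(_ N.+1 I) [k /= Nk Ak].
  by apply: (P1x k I k) => //=; rewrite Nk leqnn.
pose L := (4 * K).+1.
have L0 : 0 < L%:R :> R by rewrite ltr0n.
pose G := birkhoff_sum T F.
pose P2 (j : nat) := \bigcup_(n in [set n | (N < n <= K.*2)%N])
  ((iter n T @^-1` A) `&` [set x | G x n.*2.+1 <= j.+1%:R^-1]).
have mP2 j : measurable (P2 j).
  apply: bigcup_measurable => n _; apply: measurableI; first exact: mpre.
  apply: measurable_set_ler; last exact: measurable_cst.
  exact: measurable_birkhoff_sum.
have posG x a n : (N < n)%N -> A (iter (a + n) T x) -> G x a < G x (a + n.*2.+1)%N.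
  move=> Nn Aan; rewrite -subr_gt0 (birkhoff_sum_reflect (Tinv := Tinv))//.
  by rewrite mulr_gt0 ?ltr0n// Aan.
(* At a given point only finitely many radii up to 2K occur, each with positive gain, so the least
   gain [g] exceeds some 1/(j+1). The bound 1/(32L) = (1/8)(1/(4L)) matches the count allowed for
   [b2]. *)
have [j P2j] : exists j, (mu (P2 j) < ((32 * L%:R)^-1)%:E)%E.
  apply: nonincreasing_null_small => //; last by rewrite invr_gt0 mulr_gt0.
    move=> m n mn; apply/subsetPset => x [k kK [Ak Gk]]; exists k => //; split => //=.
    by rewrite (le_trans Gk)// lef_pV2 ?posrE// ler_nat.
  rewrite (_ : \bigcap_n _ = set0); first exact: negligible_set0.
  apply/seteqP; split => // x P2x.
  pose g := \big[Order.min/1]_(i < K.*2.+1 | (N < i)%N && (iter i T x \in A))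
    G x i.*2.+1.
  have g0 : 0 < g.
    apply: lt_bigmin => // i /andP[Ni]; rewrite inE => Ai.
    have := posG x 0%N i Ni Ai; rewrite add0n; apply: le_lt_trans.
    by rewrite /G /birkhoff_sum big_nil.
  have [k /= /andP[Nk kK] [/= Ak Gk]] := P2x (Num.trunc g^-1) I.
  have : g <= G x k.*2.+1.
    have kK' : (k < K.*2.+1)%N by [].
    by apply: (@bigmin_le_cond _ _ _ _ (Ordinal kK')); rewrite /= Nk inE.
  move=> /le_trans/(_ Gk); apply/negP; rewrite -ltNge.
  by rewrite invf_plt ?posrE// truncnS_gt.
pose delta : R := j.+1%:R^-1.
pose c := delta / L%:R.
(* This makes the chain's slope [c] equal to 100 eta, well above the upper bound 13 eta. *)
pose eta := c / 100.
have c0 : 0 < c by rewrite divr_gt0 ?invr_gt0.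
have eta0 : 0 < eta by rewrite divr_gt0.
pose P3 (m : nat) := \bigcup_(n in [set n | (m <= n)%N])
  [set x | eta < `|Bavg T Tinv F n x|].
have mP3 m : measurable (P3 m).
  apply: bigcup_measurable => n _; apply: measurable_set_ltr; first exact: measurable_cst.
  by apply: measurableT_comp => //; exact: normr_measurable.
(* The centres range over 4n + 1 <= 5n times, and 5n/80 = (1/8)(n/2). *)
have [N1 P3N1] : exists N1, (mu (P3 N1) < (80^-1)%:E)%E.
  apply: nonincreasing_null_small => //.
    move=> m n mn; apply/subsetPset => x [k /= nk Bk]; exists k => //=.
    exact: leq_trans nk.
  apply: negligibleS cvF => x P3x /= /cvgrPdist_le/(_ _ eta0)[m _ mP].
  have [k /= mk] := P3x m I.
  by have := mP k mk; rewrite /= sub0r normrN leNgt => /negbTE ->.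
pose P4 (m : nat) := [set x | m%:R <= `|F x|].
have mP4 m : measurable (P4 m).
  apply: measurable_set_ler; first exact: measurable_cst.
  by apply: measurableT_comp => //; exact: normr_measurable.
(* Since [F] is finite everywhere, its large-value sets decrease to the empty set. This controls
   [G x 1], which is [F x], the remainder for odd times. *)
have [C P4C] : exists C, (mu (P4 C) < (8^-1)%:E)%E.
  apply: nonincreasing_null_small => //.
    by move=> m n mn; apply/subsetPset => x; apply: le_trans; rewrite ler_nat.
  rewrite (_ : \bigcap_n _ = set0); first exact: negligible_set0.
  apply/seteqP; split => // x /(_ (Num.trunc `|F x|).+1 I) /=.
  by apply/negP; rewrite -ltNge truncnS_gt.
have [n [n0 N1n Cn Ln]] : exists n : nat, [/\ 0 < n%:R :> R, (N1 <= n)%N,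
    C%:R <= eta * n%:R & 4 * L%:R <= n%:R :> R].
  exists (N1 + 4 * L + (Num.trunc (C%:R / eta)).+1)%N; split.
  - by rewrite ltr0n addnS.
  - by rewrite -addnA leq_addr.
  - rewrite mulrC -ler_pdivrMr//; apply: ltW; apply: (lt_le_trans (truncnS_gt _)).
    by rewrite ler_nat leq_addl.
  - by rewrite -natrM ler_nat addnAC leq_addl.
have [mC1 C1] := visits_often_small (M := n) (q := n%:R / 16) (r := 8^-1) mT muT (mP1 K)
  ltac:(by rewrite divr_gt0) P1K ltac:(by lra).
have [mC2 C2] := visits_often_small (M := n) (q := n%:R / (4 * L%:R)) (r := 8^-1) mT muT (mP2 j)
  ltac:(by rewrite divr_gt0// mulr_gt0) P2j
  ltac:(by rewrite le_eqVlt; apply/orP; left; apply/eqP; field; rewrite lt0r_neq0).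
have n5 : (4 * n).+1%:R * 80^-1 <= 8^-1 * (n%:R / 2) :> R.
  have : (4 * n).+1%:R <= 5 * n%:R :> R.
    by rewrite -natrM ler_nat; move: n0; rewrite ltr0n; clear; lia.
  by lra.
have [mC3 C3] := visits_often_small (M := (4 * n).+1) (q := n%:R / 2) (r := 8^-1) mT muT (mP3 N1)
  ltac:(by rewrite divr_gt0) P3N1 n5.
set U1 := [set x | _] in mC1 C1; set U2 := [set x | _] in mC2 C2.
set U3 := [set x | _] in mC3 C3.
(* Four sets of measure at most 1/8 cannot cover a probability space. *)
have [x [xU1 xU2 xU3 xP4]] : exists x, [/\ ~ U1 x, ~ U2 x, ~ U3 x & ~ P4 C x].
  by apply: (@exists_outside4 _ _ _ mu) => //; exact: ltW.
pose b1 a := iter a T x \in P1 K; pose b2 a := iter a T x \in P2 j.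
apply: (@reflection_contradiction R (G x) (fun m => iter m T x \in A) b1 b2
  (fun m => iter m T x \notin P3 N1) N K N1 n delta eta) => //.
- by rewrite /G /birkhoff_sum big_nil.
- by move=> a m Nm; rewrite inE => Aam; apply/ltW/posG.
- move=> a h; rewrite /b1 inE => m /= Nm; have := h m Nm.
  by rewrite notin_setE /= addnC iterD.
- move=> a m; rewrite /b2 notin_setE => nb2 Nm; rewrite inE addnC iterD => Aam.
  rewrite /G birkhoff_sumD lerD2l leNgt; apply/negP => lt.
  by apply: nb2; exists m => //; split => //=; exact: ltW.
- move=> a m N1m; rewrite notin_setE => nP3.
  rewrite (birkhoff_sum_reflect (Tinv := Tinv))//.
  rewrite normrM ger0_norm// mulrC ler_wpM2r// leNgt; apply/negP => lt.
  by apply: nP3; exists m.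
- by rewrite /eta mulrCA mulfV// mulr1 /c divfK// lt0r_neq0.
- rewrite /G /birkhoff_sum big_nat1 /=; apply: le_trans Cn; apply: ltW.
  by rewrite ltNge; apply/negP.
- by move/negP: xU1; rewrite -ltNge.
- by move/negP: xU2; rewrite -ltNge invfM mulrA ltr_pdivlMr// mulrC.
- rewrite -(ltr_nat R) -muln2 natrM -ltr_pdivlMr//.
  under eq_bigr do rewrite negbK.
  by move/negP: xU3; rewrite -ltNge.
Qed.

(** * Arbitrary limits and both signs *)

Lemma Bavg_affine (R : realType) (X : Type) (T Tinv : X -> X) (f : X -> R)
    (s c : R) (n : nat) (x : X) :
  Bavg T Tinv (fun y => s * (f y - c)) n x = s * (Bavg T Tinv f n x - c).
Proof.
rewrite /Bavg -mulr_sumr sumrB big_const_nat subn0 iter_addr_0 mulrCA; congr (_ * _).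
by rewrite mulrBr -[c *+ _]mulr_natl mulKf// pnatr_eq0.
Qed.

(** The averages of s(f - c) tend to 0, so the centred case applies for each [N], and a countable
    union of null sets is null. The signs s = 1 and s = -1 give the two halves of the theorem. *)
Lemma eventually_one_sided_null (d : measure_display) (X : measurableType d)
    (R : realType) (mu : probability X R) (T Tinv : X -> X) (f : X -> R) (c s : R) :
  invertible_mpt_ergodic mu T Tinv -> measurable_fun setT f ->
  {ae mu, forall x, (fun n : nat => Bavg T Tinv f n x) @ \oo --> c} ->
  mu (\bigcup_(N in [set N : nat | (0 < N)%N])
        \bigcap_(n in [set n : nat | (N < n)%N])
          [set x | 0 < s * (Bavg T Tinv f n x - c)]) = 0%E.
Proof.
move=> erg mf cvf; have [_ [_ [mT [mTi _]]]] := erg.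
pose F y := s * (f y - c).
have mF : measurable_fun setT F.
  apply: measurable_funM; first exact: measurable_cst.
  by apply: measurable_funB => //; exact: measurable_cst.
have cvF : {ae mu, forall x, (fun n : nat => Bavg T Tinv F n x) @ \oo --> 0}.
  apply: filterS cvf => x cvx; under eq_fun do rewrite Bavg_affine.
  rewrite -(mulr0 s) -(subrr c); apply: cvgMr; apply: cvgB => //; exact: cvg_cst.
have mE N : measurable [set x | forall n, (N < n)%N -> 0 < Bavg T Tinv F n x].
  apply: (@bigcap_measurableType _ _ _ [set n | (N < n)%N]) => n _.
  by apply: measurable_set_ltr; [exact: measurable_cst|exact: measurable_Bavg].
have neg : mu.-negligible
    (\bigcup_N [set x | forall n, (N < n)%N -> 0 < Bavg T Tinv F n x]).
  by apply: negligible_bigcup => N; apply/negligibleP => //; exact: eventually_positive_null.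
apply/negligibleP.
  apply: bigcup_measurable => N _; apply: bigcap_measurableType => n _.
  apply: measurable_set_ltr; first exact: measurable_cst.
  apply: measurable_funM; first exact: measurable_cst.
  by apply: measurable_funB; [exact: measurable_Bavg|exact: measurable_cst].
apply: negligibleS neg => x [N _ h]; exists N => //= n Nn.
by rewrite Bavg_affine; exact: h.
Qed.

Theorem theorem4 (d : measure_display) (X : measurableType d) (R : realType)
    (mu : probability X R) (T Tinv : X -> X) (f : X -> R) (c : R) :
  invertible_mpt_ergodic mu T Tinv ->
  measurable_fun setT f ->
  {ae mu, forall x, (fun n : nat => Bavg T Tinv f n x) @ \oo --> c} ->
  mu (\bigcup_(N in [set N : nat | (0 < N)%N])
        \bigcap_(n in [set n : nat | (N < n)%N]) [set x | c < Bavg T Tinv f n x])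
    = 0%E /\
  mu (\bigcup_(N in [set N : nat | (0 < N)%N])
        \bigcap_(n in [set n : nat | (N < n)%N]) [set x | Bavg T Tinv f n x < c])
    = 0%E.
Proof.
move=> erg mf cvf.
have null s := eventually_one_sided_null s erg mf cvf.
split.
  rewrite -[RHS](null 1); congr (mu _); apply: eq_bigcupr => N _.
  by apply: eq_bigcapr => n _; apply/seteqP; split => x /=; rewrite mul1r subr_gt0.
rewrite -[RHS](null (-1)); congr (mu _); apply: eq_bigcupr => N _.
by apply: eq_bigcapr => n _; apply/seteqP; split => x /=;
  rewrite mulN1r opprB subr_gt0.
Qed.
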